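(* Let $\boldsymbol{p}=(\boldsymbol{p}_1,\dots,\boldsymbol{p}_K)^T$ be a vector of compact real intervals, let $A^{(1)},\dots,A^{(K)}\in\mathbb{R}^{m\times n}$ and $b^{(1)},\dots,b^{(K)}\in\mathbb{R}^m$, and let $\{1,\dots,K\}$ be the disjoint union of $\mathcal{K}^{\forall}$ and $\mathcal{K}^{\exists}$. Then $\Sigma^{AE}_{unb}\subseteq\Sigma^{AE}_{ker}$.
   Context: An interval is a set $\boldsymbol{p}_k=[\underline{p}_k,\overline{p}_k]\subset\mathbb{R}$ with real endpoints $\underline{p}_k\le\overline{p}_k$ (degenerate intervals are allowed). For $p\in\mathbb{R}^K$, $A(p)=\sum_{k=1}^K p_kA^{(k)}$ and $b(p)=\sum_{k=1}^K p_kb^{(k)}$. Each parameter $p_k$ is associated with a universal quantifier ($k\in\mathcal{K}^{\forall}$) or an existential quantifier ($k\in\mathcal{K}^{\exists}$). Accordingly write $p=(p^{\forall},p^{\exists})$ and $\boldsymbol{p}=(\boldsymbol{p}^{\forall},\boldsymbol{p}^{\exists})$, where $p^{\forall}=(p_k)_{k\in\mathcal{K}^{\forall}}$ and $p^{\exists}=(p_k)_{k\in\mathcal{K}^{\exists}}$. The AE parametric solution set is $\Sigma^{AE}=\{x\in\mathbb{R}^n : \forall p^{\forall}\in\boldsymbol{p}^{\forall}\ \exists p^{\exists}\in\boldsymbol{p}^{\exists}:\ A(p)x=b(p)\}$. The set of its unbounded directions is $\Sigma^{AE}_{unb}=\{y\in\mathbb{R}^n : \exists x\in\Sigma^{AE}\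 \forall\alpha\ge 0:\ x+\alpha y\in\Sigma^{AE}\}$. The kernel of the AE parametric solution set is $\Sigma^{AE}_{ker}=\{y\in\mathbb{R}^n : \forall p^{\forall}\in\boldsymbol{p}^{\forall}\ \exists p^{\exists}\in\boldsymbol{p}^{\exists}:\ A(p)y=0\}$. *)

(* Defs.v *)
From HB Require Import structures.
From mathcomp Require Import all_boot all_order all_algebra.
From mathcomp Require Import all_classical all_reals.

Set Implicit Arguments.
Unset Strict Implicit.
Unset Printing Implicit Defensive.

Import Order.TTheory GRing.Theory Num.Theory.
Local Open Scope classical_set_scope.
Local Open Scope ring_scope.

(* A(p) = \sum_k p_k A^(k); with q = 1 this also gives b(p). *)
Definition param_mx (R : realType) (K m q : nat)
    (M : 'I_K -> 'M[R]_(m, q)) (p : 'cV[R]_K) : 'M[R]_(m, q) :=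
  \sum_(k < K) p k 0 *: M k.

Definition subparam (R : realType) (K : nat) (S : {set 'I_K}) : Type :=
  {k : 'I_K | k \in S} -> R.

Definition in_subbox (R : realType) (K : nat) (I : 'I_K -> interval R)
    (S : {set 'I_K}) (u : subparam R S) : Prop :=
  forall k : {k : 'I_K | k \in S}, u k \in I (val k).

(* The vector p = (u, v). The last default value is never reached when S and T
   cover 'I_K, and the priority given to S is irrelevant when S and T are
   disjoint. *)
Definition param_join (R : realType) (K : nat) (S T : {set 'I_K})
    (u : subparam R S) (v : subparam R T) : 'cV[R]_K :=
  \col_(k < K)
    if insub k is Some i then u i
    else if insub k is Some j then v j
    else 0.

(* Below, KA and KE are the index sets of the universally and of the
   existentially quantified parameters. *)
Definition AE_sol (R : realType) (K m n : nat) (I : 'I_K -> interval R)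
    (KA KE : {set 'I_K}) (A : 'I_K -> 'M[R]_(m, n)) (b : 'I_K -> 'cV[R]_m) :
    set 'cV[R]_n :=
  [set x | forall pA : subparam R KA, in_subbox I pA ->
    exists pE : subparam R KE, in_subbox I pE /\
      param_mx A (param_join pA pE) *m x = param_mx b (param_join pA pE)].

Definition AE_unb (R : realType) (K m n : nat) (I : 'I_K -> interval R)
    (KA KE : {set 'I_K}) (A : 'I_K -> 'M[R]_(m, n)) (b : 'I_K -> 'cV[R]_m) :
    set 'cV[R]_n :=
  [set y | exists x : 'cV[R]_n, AE_sol I KA KE A b x /\
    forall alpha : R, 0 <= alpha -> AE_sol I KA KE A b (x + alpha *: y)].

Definition AE_ker (R : realType) (K m n : nat) (I : 'I_K -> interval R)
    (KA KE : {set 'I_K}) (A : 'I_K -> 'M[R]_(m, n)) : set 'cV[R]_n :=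
  [set y | forall pA : subparam R KA, in_subbox I pA ->
    exists pE : subparam R KE, in_subbox I pE /\
      param_mx A (param_join pA pE) *m y = 0].

(* Main.v *)
(* For alpha > 0, the parameters p witnessing that x + alpha y is a solution
   satisfy alpha A(p) y = b(p) - A(p) x. For fixed p^forall, the right-hand side
   is bounded over the compact box of p^exists, hence |A(p) y| gets arbitrarily
   small there; as it attains its minimum, it vanishes somewhere. *)
Require Import Defs.
From HB Require Import structures.
From mathcomp Require Import all_boot all_order all_algebra.
From mathcomp Require Import all_classical all_reals.
From mathcomp Require Import topology normedtype derive.

Set Implicit Arguments.
Unset Strict Implicit.
Unset Printing Implicit Defensive.

Import Order.TTheory GRing.Theory Num.Theory.
Import numFieldNormedType.Exports.
Local Open Scope classical_set_scope.
Local Open Scope ring_scope.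

(** A finite sum of absolute values, so that continuity reduces to continuity of the entries. *)
Definition norm1 (R : realType) (m : nat) (v : 'cV[R]_m) : R :=
  \sum_(i < m) `|v i 0|.

Lemma norm1_ge0 (R : realType) (m : nat) (v : 'cV[R]_m) : 0 <= norm1 v.
Proof. by apply: sumr_ge0. Qed.

Lemma norm1_eq0 (R : realType) (m : nat) (v : 'cV[R]_m) :
  norm1 v = 0 -> v = 0.
Proof.
move=> v0; apply/matrixP => i j; rewrite ord1 mxE; apply/eqP.
by rewrite -normr_eq0 (psumr_eq0P _ v0).
Qed.

Lemma norm1Z (R : realType) (m : nat) (a : R) (v : 'cV[R]_m) :
  norm1 (a *: v) = `|a| * norm1 v.
Proof. by rewrite /norm1 mulr_sumr; apply: eq_bigr => i _; rewrite mxE normrM. Qed.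

(** Makes [A(p) x] a parametric vector with coefficients [A k *m x], so that one continuity lemma
    covers both [A(p) y] and [b(p) - A(p) x]. *)
Lemma param_mxM (R : realType) (K m n q : nat) (A : 'I_K -> 'M[R]_(m, n))
    (x : 'M[R]_(n, q)) (p : 'cV[R]_K) :
  param_mx A p *m x = param_mx (fun k => A k *m x) p.
Proof.
by rewrite /param_mx mulmx_suml; apply: eq_bigr => k _; rewrite -scalemxAl.
Qed.

Lemma param_mxB (R : realType) (K m q : nat) (M N : 'I_K -> 'M[R]_(m, q))
    (p : 'cV[R]_K) :
  param_mx (fun k => M k - N k) p = param_mx M p - param_mx N p.
Proof.
by rewrite /param_mx -sumrB; apply: eq_bigr => k _; rewrite scalerBr.
Qed.

(* [prod_topology] puts the topology of pointwise convergence on [subparam]. *)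
Lemma subbox_compact (R : realType) (K : nat) (pl pu : 'I_K -> R)
    (S : {set 'I_K}) :
  @compact (prod_topology (fun _ : {k : 'I_K | k \in S} => R))
    [set u | in_subbox (fun k => `[pl k, pu k]%R) u].
Proof.
apply: (@tychonoff _ _ (fun k => [set` `[pl (val k), pu (val k)]%R])) => k.
exact: segment_compact.
Qed.

(** For fixed [u], every coordinate of the joined vector is constant or a projection of [v]; hence
    each entry is affine in [v]. *)
Lemma norm1_param_join_continuous (R : realType) (K m : nat) (S T : {set 'I_K})
    (V : 'I_K -> 'cV[R]_m) (u : subparam R S) :
  continuous (fun v : prod_topology (fun _ : {k : 'I_K | k \in T} => R) =>
    norm1 (param_mx V (param_join u v))).
Proof.
pose X := prod_topology (fun _ : {k : 'I_K | k \in T} => R).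
have join_continuous k : continuous (fun v : X => param_join u v k 0).
  have [[c joinE]|[j joinE]] :
      (exists c, (fun v : X => param_join u v k 0) = fun=> c) \/
      (exists j, (fun v : X => param_join u v k 0) = fun v => v j).
  - case ES : (insub k : option {k : 'I_K | k \in S}) => [i|].
      by left; exists (u i); apply/funext => v; rewrite mxE ES.
    case ET : (insub k : option {k : 'I_K | k \in T}) => [j|].
      by right; exists j; apply/funext => v; rewrite mxE ES ET.
    by left; exists 0; apply/funext => v; rewrite mxE ES ET.
  - by rewrite joinE; exact: (@cst_continuous X R c).
  - by rewrite joinE; exact: (@proj_continuous _ (fun=> R) j).
have entry_continuous i :
    continuous (fun v : X => param_mx V (param_join u v) i 0).
  rewrite (_ : (fun v : X => _) =
    fun v : X => \sum_(k < K) param_join u v k 0 * V k i 0); last first.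
    by apply/funext => w; rewrite summxE; apply: eq_bigr => k _; rewrite mxE.
  apply: continuous_big => [|k _ v]; first exact: add_continuous.
  exact: (@continuous_comp X R R _ ( *%R^~ (V k i 0)) v
    (join_continuous k v) (@mulrr_continuous R _ _)).
apply: continuous_big => [|i _ v]; first exact: add_continuous.
exact: (@continuous_comp X R R _ Num.norm v
  (entry_continuous i v) (@norm_continuous _ R _)).
Qed.

Theorem theorem5 (R : realType) (K m n : nat)
    (pl pu : 'I_K -> R) (Hp : forall k : 'I_K, pl k <= pu k)
    (A : 'I_K -> 'M[R]_(m, n)) (b : 'I_K -> 'cV[R]_m)
    (KA KE : {set 'I_K})
    (Hdisj : (KA :&: KE = finset.set0)%SET)
    (Hcover : (KA :|: KE = [set: 'I_K])%SET) :
  AE_unb (fun k => `[pl k, pu k]%R) KA KE A b `<=`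
  AE_ker (fun k => `[pl k, pu k]%R) KA KE A.
Proof.
move=> y [x [solx solxy]] pA pA_box.
pose res k := b k - A k *m x.
pose box : set (prod_topology (fun _ : {k : 'I_K | k \in KE} => R)) :=
  [set u | in_subbox (fun k => `[pl k, pu k]%R) u].
(* The extreme value theorem needs a nonempty box; the witness for [x] at [pA] provides a point. *)
have box0 : box !=set0 by have [pE [pE_box _]] := solx pA pA_box; exists pE.
have box_compact : compact box := @subbox_compact _ _ pl pu KE.
(* The witness for [x + alpha *: y] changes with [alpha], so both bounds are taken over the whole
   box and are independent of [alpha]. *)
have [u1 _ u1_max] := compact_EVT_max box0 box_compact
  (continuous_subspaceT (norm1_param_join_continuous (V := res) (u := pA))).
have [u0 u0_box u0_min] := compact_EVT_min box0 box_compact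
  (continuous_subspaceT
     (norm1_param_join_continuous (V := fun k => A k *m y) (u := pA))).
set M := norm1 _ in u1_max; set c := norm1 _ in u0_min.
have c_bound alpha : 0 <= alpha -> alpha * c <= M.
  move=> alpha0; have [pE [pE_box solE]] := solxy _ alpha0 pA pA_box.
  have pE_in : (pE : prod_topology _) \in box by exact: mem_set.
  (* Substituting [b(p) = A(p) (x + alpha y)] into the residual leaves [alpha A(p) y], whose norm is
     at least [alpha * c]. *)
  apply: le_trans (u1_max _ pE_in); rewrite /res param_mxB -param_mxM -solE.
  rewrite mulmxDr addrC addKr -scalemxAr norm1Z ger0_norm //.
  by rewrite ler_wpM2l // param_mxM u0_min.
(* The minimizer is the required witness once the minimum [c] is shown to be zero. *)
exists u0; split; first exact: set_mem u0_box.
rewrite param_mxM; apply: norm1_eq0; apply/eqP/negPn/negP => c_neq0.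
have c_gt0 : 0 < c by rewrite lt_neqAle eq_sym c_neq0 norm1_ge0.
have M_ge0 : 0 <= M := norm1_ge0 _.
(* This [alpha] makes [alpha * c] equal to [M + 1], which exceeds the bound [M]. *)
have := c_bound ((M + 1) / c) (divr_ge0 (addr_ge0 M_ge0 ler01) (ltW c_gt0)).
by rewrite divfK ?gt_eqF // gerDl ler10.
Qed.
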